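(* Let $\varphi:\mathbb{D}\to\mathbb{D}$ be an inner function with $\varphi(0)\neq 0$, and let $C_\varphi f=f\circ\varphi$ be the corresponding composition operator on $H^2(\mathbb{D})$. Then for $f\in H^2(\mathbb{D})$, $$\|C_\varphi f\|=\sqrt{\frac{1+|\varphi(0)|}{1-|\varphi(0)|}}\;\|f\|$$ holds if and only if $f\equiv 0$. In particular, the operator norm $\|C_\varphi\|=\sqrt{\frac{1+|\varphi(0)|}{1-|\varphi(0)|}}$ is not attained by any nonzero function of $H^2(\mathbb{D})$.
   Context: $\mathbb{D}$ is the open unit disc. $H^2(\mathbb{D})$ is the Hardy space of holomorphic $f(z)=\sum_{n\ge0}a_nz^n$ on $\mathbb{D}$ with $\|f\|^2=\sum_{n\ge0}|a_n|^2<\infty$. An inner function is a holomorphic map $\varphi:\mathbb{D}\to\mathbb{D}$ whose radial limits satisfy $|\varphi(e^{i\theta})|=1$ for almost every $\theta\in[0,2\pi)$. For an inner function $\varphi$ it is known that $\|C_\varphi\|=\sqrt{(1+|\varphi(0)|)/(1-|\varphi(0)|)}$. *)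

(* Defs.v *)
From Stdlib Require Import Reals.
From Coquelicot Require Import Coquelicot.
Open Scope R_scope.

Definition in_disc (z : C) : Prop := Cmod z < 1.

Definition Cpow (z : C) (n : nat) : C := pow_n (K := C_Ring) z n.

Definition polar (r t : R) : C := (r * cos t, r * sin t)%R.

Definition holomorphic_on_disc (f : C -> C) : Prop :=
  forall z : C, in_disc z -> ex_derive (K := C_AbsRing) (V := C_NormedModule) f z.

Definition taylor_coeffs (f : C -> C) (a : nat -> C) : Prop :=
  forall z : C, in_disc z ->
    is_series (K := C_AbsRing) (V := C_NormedModule) (fun n => Cmult (a n) (Cpow z n)) (f z).

Definition null_set (A : R -> Prop) : Prop :=
  forall eps : R, 0 < eps ->
    exists lo hi : nat -> R,
      (forall n, lo n <= hi n) /\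
      (forall x, A x -> exists n, lo n < x < hi n) /\
      (forall N, sum_f_R0 (fun n => hi n - lo n) N <= eps).

Definition radial_limit (f : C -> C) (t : R) (L : C) : Prop :=
  forall eps : R, 0 < eps -> exists delta : R, 0 < delta /\
    forall r : R, 1 - delta < r < 1 -> Cmod (Cminus (f (polar r t)) L) < eps.

Definition inner_function (phi : C -> C) : Prop :=
  holomorphic_on_disc phi /\
  (forall z, in_disc z -> in_disc (phi z)) /\
  null_set (fun t => 0 <= t < 2 * PI /\
                     ~ (exists L : C, radial_limit phi t L /\ Cmod L = 1)).

Definition sq_summable (a : nat -> C) : Prop :=
  ex_series (fun n => (Cmod (a n)) ^ 2).

Definition H2_norm (a : nat -> C) : R := sqrt (Series (fun n => (Cmod (a n)) ^ 2)).

(* Main.v *)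
Require Import Defs.
From Stdlib Require Import Reals Lra Lia Classical ClassicalEpsilon.
From Coquelicot Require Import Coquelicot.
Open Scope R_scope.

(** For a truncation p of f the function |p|^2 is dominated on the disc by the real part of an explicit polynomial G, with equality on the
    unit circle.  Since Re(G o phi) is harmonic, its mean over |z| = r is Re G(phi(0)),
    and this mean dominates, up to the truncation error, that of |f o phi|^2, which is
    sum |c_n|^2 r^(2n).  Expanding G at w = phi(0) and applying
    2|a_i a_j| <= |a_i|^2 + |a_j|^2 gives
    Re G(w) <= (1+|w|)/(1-|w|) sum |a_n|^2 - sum |w|^(n+1)/(1-|w|) |a_n|^2,
    and the subtracted sum is positive unless f = 0.

    Holomorphy here is bare complex differentiability, so the mean value property is
    obtained from Goursat's bisection argument, applied in polar coordinates to the closed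
    form Im(h dz / z). *)

(** * Goursat's lemma *)

(** Nested intervals: the right endpoints [u n + L / 2 ^ n] decrease, so the left endpoints increase
    to a limit that lies below every right endpoint. *)
Lemma bisection_limit (u : nat -> R) (L : R) :
  0 <= L ->
  (forall n, u n <= u (S n) <= u n + L / 2 ^ S n) ->
  exists x, forall n, u n <= x <= u n + L / 2 ^ n.
Proof.
intros HL Hu.
assert (Hup : forall n, u (S n) + L / 2 ^ S n <= u n + L / 2 ^ n).
{ intros n. destruct (Hu n) as [_ H].
  assert (L / 2 ^ n = L / 2 ^ S n + L / 2 ^ S n).
  { simpl. field. apply pow_nonzero. lra. }
  lra. }
assert (Hpos : forall n, 0 <= L / 2 ^ n).
{ intros n. apply Rdiv_le_0_compat; [lra | apply pow_lt; lra]. }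
assert (Hinc : forall n, u n <= u (S n)) by (intros n; apply Hu).
assert (Hb : forall n, u n + L / 2 ^ n <= u 0%nat + L).
{ induction n as [|n IH]; [simpl; lra | specialize (Hup n); lra]. }
destruct (ex_finite_lim_seq_incr u (u 0%nat + L) Hinc) as [x Hx].
{ intros n. specialize (Hb n). specialize (Hpos n). lra. }
exists x. intros n. split.
- exact (is_lim_seq_incr_compare u x Hx Hinc n).
- assert (Hle : forall k, u (n + k)%nat <= u n + L / 2 ^ n).
  { intros k.
    enough (u (n + k)%nat + L / 2 ^ (n + k) <= u n + L / 2 ^ n)
      by (specialize (Hpos (n + k)%nat); lra).
    induction k as [|k IH].
    - rewrite Nat.add_0_r. lra.
    - rewrite Nat.add_succ_r. specialize (Hup (n + k)%nat). lra. }
  apply (is_lim_seq_le_loc u (fun _ => u n + L / 2 ^ n) x (u n + L / 2 ^ n)).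
  + exists n. intros m Hm. replace m with (n + (m - n))%nat by lia. apply Hle.
  + exact Hx.
  + apply is_lim_seq_const.
Qed.

(** [Bad x y n] speaks of the rectangle with lower left corner [(x, y)] and sides [L / 2 ^ n],
    [M / 2 ^ n]. Choosing a bad quarter at each stage gives nested rectangles that shrink to a
    point. *)
Lemma rectangle_bisection (Bad : R -> R -> nat -> Prop) (a c L M : R) :
  0 <= L -> 0 <= M ->
  (forall x y n, Bad x y n -> exists x' y',
     (x' = x \/ x' = x + L / 2 ^ S n) /\ (y' = y \/ y' = y + M / 2 ^ S n) /\
     Bad x' y' (S n)) ->
  Bad a c 0%nat ->
  exists x0 y0, a <= x0 <= a + L /\ c <= y0 <= c + M /\
    forall n, exists x y, Bad x y n /\
      a <= x /\ x + L / 2 ^ n <= a + L /\ c <= y /\ y + M / 2 ^ n <= c + M /\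
      x <= x0 <= x + L / 2 ^ n /\ y <= y0 <= y + M / 2 ^ n.
Proof.
intros HL HM Hstep Hbad.
(* The step is made total by staying put at a corner that is not bad, so that it can be chosen as a
   function and iterated. *)
assert (Hchoice : forall n (p : R * R), exists q : R * R,
  (fst q = fst p \/ fst q = fst p + L / 2 ^ S n) /\
  (snd q = snd p \/ snd q = snd p + M / 2 ^ S n) /\
  (Bad (fst p) (snd p) n -> Bad (fst q) (snd q) (S n))).
{ intros n [x y]. destruct (classic (Bad x y n)) as [B|B].
  - destruct (Hstep x y n B) as (x' & y' & H1 & H2 & H3).
    exists (x', y'). simpl. tauto.
  - exists (x, y). simpl. tauto. }
set (next n p := proj1_sig (constructive_indefinite_description _ (Hchoice n p))).
assert (Hnext : forall n p,
  (fst (next n p) = fst p \/ fst (next n p) = fst p + L / 2 ^ S n) /\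
  (snd (next n p) = snd p \/ snd (next n p) = snd p + M / 2 ^ S n) /\
  (Bad (fst p) (snd p) n -> Bad (fst (next n p)) (snd (next n p)) (S n))).
{ intros n p. exact (proj2_sig (constructive_indefinite_description _ (Hchoice n p))). }
set (s := fix s n := match n with O => (a, c) | S n => next n (s n) end).
assert (HB : forall n, Bad (fst (s n)) (snd (s n)) n).
{ induction n as [|n IH]; [exact Hbad | apply (Hnext n (s n)), IH]. }
assert (HposL : forall n, 0 <= L / 2 ^ n).
{ intros n. apply Rdiv_le_0_compat; [lra | apply pow_lt; lra]. }
assert (HposM : forall n, 0 <= M / 2 ^ n).
{ intros n. apply Rdiv_le_0_compat; [lra | apply pow_lt; lra]. }
assert (Hx : forall n, fst (s n) <= fst (s (S n)) <= fst (s n) + L / 2 ^ S n).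
{ intros n. destruct (Hnext n (s n)) as [H _]. change (s (S n)) with (next n (s n)).
  specialize (HposL (S n)). lra. }
assert (Hy : forall n, snd (s n) <= snd (s (S n)) <= snd (s n) + M / 2 ^ S n).
{ intros n. destruct (Hnext n (s n)) as [_ [H _]]. change (s (S n)) with (next n (s n)).
  specialize (HposM (S n)). lra. }
destruct (bisection_limit _ L HL Hx) as [x0 Hx0].
destruct (bisection_limit _ M HM Hy) as [y0 Hy0].
assert (Hhalf : forall l n, l / 2 ^ n = l / 2 ^ S n + l / 2 ^ S n).
{ intros l n. simpl. field. apply pow_nonzero. lra. }
exists x0, y0.
generalize (Hx0 0%nat) (Hy0 0%nat). simpl. rewrite 2!Rdiv_1_r. intros Hx00 Hy00.
split; [exact Hx00 | split; [exact Hy00|]].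
intros n. exists (fst (s n)), (snd (s n)).
assert (Hin : a <= fst (s n) /\ fst (s n) + L / 2 ^ n <= a + L /\
              c <= snd (s n) /\ snd (s n) + M / 2 ^ n <= c + M).
{ induction n as [|n IH].
  - simpl. lra.
  - specialize (Hx n). specialize (Hy n).
    rewrite (Hhalf L n), (Hhalf M n) in IH. lra. }
split; [apply HB|]. specialize (Hx0 n). specialize (Hy0 n). tauto.
Qed.

(** The counterclockwise integral of P dx + Q dy around the rectangle, with opposite sides merged
    into one integrand. *)
Definition boundary_integral (P Q : R -> R -> R) (a b c d : R) : R :=
  RInt (fun x => P x c - P x d) a b + RInt (fun y => Q b y - Q a y) c d.

Lemma differentiable_pt_lim_continuous (f : R -> R -> R) (x y lx ly : R) :
  differentiable_pt_lim f x y lx ly ->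
  continuous (fun t => f t y) x /\ continuous (fun t => f x t) y.
Proof.
intros H.
assert (C2 : continuity_2d_pt f x y).
{ apply differentiable_continuity_pt. exists lx, ly. exact H. }
split; apply continuity_pt_filterlim; apply continuity_pt_locally; intros eps;
  destruct (C2 eps) as [d Hd]; exists d; intros t Ht; apply Hd.
- exact Ht.
- rewrite Rminus_diag, Rabs_R0. apply cond_pos.
- rewrite Rminus_diag, Rabs_R0. apply cond_pos.
- exact Ht.
Qed.

Lemma RInt_Rminus (f g : R -> R) (a b : R) :
  ex_RInt f a b -> ex_RInt g a b ->
  RInt (fun x => f x - g x) a b = RInt f a b - RInt g a b.
Proof. exact (RInt_minus (V := R_CompleteNormedModule) f g a b). Qed.

Lemma ex_RInt_Rminus (f g : R -> R) (a b : R) :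
  ex_RInt f a b -> ex_RInt g a b -> ex_RInt (fun x => f x - g x) a b.
Proof. exact (ex_RInt_minus (V := R_NormedModule) f g a b). Qed.

Section Goursat.

Variables (P Q : R -> R -> R) (a b c d : R).
Hypothesis Hab : a < b.
Hypothesis Hcd : c < d.
(** The shared [B] makes P dx + Q dy closed. The partial derivatives need not be continuous, so
    bisection takes the place of Green's theorem. *)
Hypothesis closed_form : forall x y, a <= x <= b -> c <= y <= d ->
  exists A B D, differentiable_pt_lim P x y A B /\ differentiable_pt_lim Q x y B D.

Lemma ex_RInt_P (x1 x2 y : R) :
  a <= x1 <= x2 -> x2 <= b -> c <= y <= d -> ex_RInt (fun x => P x y) x1 x2.
Proof.
intros H1 H2 Hy. apply (ex_RInt_continuous (V := R_CompleteNormedModule)). intros x Hx.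
rewrite Rmin_left, Rmax_right in Hx by lra.
destruct (closed_form x y) as (A & B & D & HP & _); [lra | lra |].
apply (differentiable_pt_lim_continuous P x y A B HP).
Qed.

Lemma ex_RInt_Q (x y1 y2 : R) :
  a <= x <= b -> c <= y1 <= y2 -> y2 <= d -> ex_RInt (fun y => Q x y) y1 y2.
Proof.
intros Hx H1 H2. apply (ex_RInt_continuous (V := R_CompleteNormedModule)). intros y Hy.
rewrite Rmin_left, Rmax_right in Hy by lra.
destruct (closed_form x y) as (A & B & D & _ & HQ); [lra | lra |].
apply (differentiable_pt_lim_continuous Q x y B D HQ).
Qed.

Lemma boundary_integral_split (x1 x2 y1 y2 : R) :
  a <= x1 <= x2 -> x2 <= b -> c <= y1 <= y2 -> y2 <= d ->
  boundary_integral P Q x1 x2 y1 y2 =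
    RInt (fun x => P x y1) x1 x2 - RInt (fun x => P x y2) x1 x2 +
    (RInt (fun y => Q x2 y) y1 y2 - RInt (fun y => Q x1 y) y1 y2).
Proof.
intros Hx Hx' Hy Hy'. unfold boundary_integral. f_equal.
- apply (RInt_Rminus (fun x => P x y1) (fun x => P x y2)); apply ex_RInt_P; lra.
- apply (RInt_Rminus (fun y => Q x2 y) (fun y => Q x1 y)); apply ex_RInt_Q; lra.
Qed.

(** The outer sides are cut by Chasles' relation; each inner edge is traversed once in each
    direction and cancels. *)
Lemma boundary_integral_quarters (x1 x2 x3 y1 y2 y3 : R) :
  a <= x1 <= x2 -> x2 <= x3 <= b -> c <= y1 <= y2 -> y2 <= y3 <= d ->
  boundary_integral P Q x1 x3 y1 y3 =
    boundary_integral P Q x1 x2 y1 y2 + boundary_integral P Q x2 x3 y1 y2 +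
    (boundary_integral P Q x1 x2 y2 y3 + boundary_integral P Q x2 x3 y2 y3).
Proof.
intros Hx1 Hx2 Hy1 Hy2.
rewrite !boundary_integral_split by lra.
rewrite <- (RInt_Chasles (fun x => P x y1) x1 x2 x3) by (apply ex_RInt_P; lra).
rewrite <- (RInt_Chasles (fun x => P x y3) x1 x2 x3) by (apply ex_RInt_P; lra).
rewrite <- (RInt_Chasles (fun y => Q x1 y) y1 y2 y3) by (apply ex_RInt_Q; lra).
rewrite <- (RInt_Chasles (fun y => Q x3 y) y1 y2 y3) by (apply ex_RInt_Q; lra).
unfold plus; simpl. ring.
Qed.

(* On a small rectangle the affine parts of P and Q contribute opposite constants. *)
Lemma boundary_integral_small (x0 y0 eta : R) :
  a <= x0 <= b -> c <= y0 <= d -> 0 < eta ->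
  exists delta, 0 < delta /\ forall x l y m s,
    a <= x -> x + l <= b -> c <= y -> y + m <= d ->
    x <= x0 <= x + l -> y <= y0 <= y + m ->
    l <= s -> m <= s -> s < delta ->
    Rabs (boundary_integral P Q x (x + l) y (y + m)) <= 4 * eta * s ^ 2.
Proof.
intros Hx0 Hy0 Heta.
destruct (closed_form x0 y0 Hx0 Hy0) as (A & B & D & HP & HQ).
destruct (HP (mkposreal eta Heta)) as [d1 Hd1].
destruct (HQ (mkposreal eta Heta)) as [d2 Hd2]. simpl in Hd1, Hd2.
exists (Rmin d1 d2). split; [apply Rmin_pos; apply cond_pos|].
intros x l y m s Ha Hb Hc Hd Hx Hy Hl Hm Hs.
assert (Hs1 := Rlt_le_trans _ _ _ Hs (Rmin_l _ _)).
assert (Hs2 := Rlt_le_trans _ _ _ Hs (Rmin_r _ _)).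
assert (HeP : forall u v, x <= u <= x + l -> y <= v <= y + m ->
  Rabs (P u v - P x0 y0 - (A * (u - x0) + B * (v - y0))) <= eta * s).
{ intros u v Hu Hv.
  assert (Rabs (u - x0) <= s) by (apply Rabs_le; lra).
  assert (Rabs (v - y0) <= s) by (apply Rabs_le; lra).
  eapply Rle_trans; [apply Hd1; lra|].
  apply Rmult_le_compat_l; [lra | apply Rmax_lub; lra]. }
assert (HeQ : forall u v, x <= u <= x + l -> y <= v <= y + m ->
  Rabs (Q u v - Q x0 y0 - (B * (u - x0) + D * (v - y0))) <= eta * s).
{ intros u v Hu Hv.
  assert (Rabs (u - x0) <= s) by (apply Rabs_le; lra).
  assert (Rabs (v - y0) <= s) by (apply Rabs_le; lra).
  eapply Rle_trans; [apply Hd2; lra|].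
  apply Rmult_le_compat_l; [lra | apply Rmax_lub; lra]. }
assert (Hsplit : boundary_integral P Q x (x + l) y (y + m) =
  RInt (fun u => P u y - P u (y + m) - - (B * m)) x (x + l) +
  RInt (fun v => Q (x + l) v - Q x v - B * l) y (y + m)).
{ unfold boundary_integral.
  rewrite (RInt_Rminus          (fun u => P u y - P u (y + m)) (fun _ => - (B * m)) x (x + l)).
  rewrite (RInt_Rminus          (fun v => Q (x + l) v - Q x v) (fun _ => B * l) y (y + m)).
  rewrite 2!RInt_const. unfold scal; simpl. unfold mult; simpl. ring.
  - apply ex_RInt_Rminus; apply ex_RInt_Q; lra.
  - apply ex_RInt_const.
  - apply ex_RInt_Rminus; apply ex_RInt_P; lra.
  - apply ex_RInt_const. }
rewrite Hsplit.
eapply Rle_trans; [apply Rabs_triang|].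
assert (H1 : Rabs (RInt (fun u => P u y - P u (y + m) - - (B * m)) x (x + l))
             <= (x + l - x) * (2 * eta * s)).
{ apply abs_RInt_le_const; [lra | |].
  - apply ex_RInt_Rminus; [|apply ex_RInt_const].
    apply ex_RInt_Rminus; apply ex_RInt_P; lra.
  - intros u Hu.
    assert (K1 := HeP u y ltac:(lra) ltac:(lra)).
    assert (K2 := HeP u (y + m) ltac:(lra) ltac:(lra)).
    apply Rabs_le_between in K1. apply Rabs_le_between in K2.
    apply Rabs_le. lra. }
assert (H2 : Rabs (RInt (fun v => Q (x + l) v - Q x v - B * l) y (y + m))
             <= (y + m - y) * (2 * eta * s)).
{ apply abs_RInt_le_const; [lra | |].
  - apply ex_RInt_Rminus; [|apply ex_RInt_const].
    apply ex_RInt_Rminus; apply ex_RInt_Q; lra.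
  - intros v Hv.
    assert (K1 := HeQ x v ltac:(lra) ltac:(lra)).
    assert (K2 := HeQ (x + l) v ltac:(lra) ltac:(lra)).
    apply Rabs_le_between in K1. apply Rabs_le_between in K2.
    apply Rabs_le. lra. }
assert (0 <= 2 * eta * s) by (apply Rmult_le_pos; lra).
assert ((x + l - x) * (2 * eta * s) <= s * (2 * eta * s))
  by (apply Rmult_le_compat_r; lra).
assert ((y + m - y) * (2 * eta * s) <= s * (2 * eta * s))
  by (apply Rmult_le_compat_r; lra).
nra.
Qed.

(** If the integral had absolute value I > 0, some quarter would carry at least I / 4, and so on:
    after n steps a rectangle of size 2^(-n) carries at least I / 4^n. Near the limit point this
    contradicts [boundary_integral_small], whose bound is an arbitrarily small multiple of
    4^(-n). *)
Theorem goursat_rectangle : boundary_integral P Q a b c d = 0.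
Proof.
apply NNPP. intros Hne.
set (I := Rabs (boundary_integral P Q a b c d)).
assert (HI : 0 < I) by (apply Rabs_pos_lt; exact Hne).
set (L := b - a). set (M := d - c).
set (Bad x y n := (a <= x /\ x + L / 2 ^ n <= b /\ c <= y /\ y + M / 2 ^ n <= d) /\
  I / 4 ^ n <= Rabs (boundary_integral P Q x (x + L / 2 ^ n) y (y + M / 2 ^ n))).
assert (Hhalf : forall l n, l / 2 ^ n = l / 2 ^ S n + l / 2 ^ S n).
{ intros l n. simpl. field. apply pow_nonzero. lra. }
assert (HposL : forall n, 0 < L / 2 ^ n).
{ intros n. apply Rdiv_lt_0_compat; [unfold L; lra | apply pow_lt; lra]. }
assert (HposM : forall n, 0 < M / 2 ^ n).
{ intros n. apply Rdiv_lt_0_compat; [unfold M; lra | apply pow_lt; lra]. }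
destruct (rectangle_bisection Bad a c L M) as (x0 & y0 & Hx0 & Hy0 & Hn).
- unfold L; lra.
- unfold M; lra.
- intros x y n [(Ha & Hb & Hc & Hd) HB].
  rewrite (Hhalf L n) in Hb, HB. rewrite (Hhalf M n) in Hd, HB.
  specialize (HposL (S n)). specialize (HposM (S n)).
  unfold Bad.
  set (l := L / 2 ^ S n) in *. set (m := M / 2 ^ S n) in *.
  rewrite (boundary_integral_quarters x (x + l) (x + (l + l)) y (y + m) (y + (m + m))) in HB
    by lra.
  replace (I / 4 ^ n) with (4 * (I / 4 ^ S n)) in HB
    by (simpl; field; apply pow_nonzero; lra).
  replace (x + (l + l)) with (x + l + l) in * by ring.
  replace (y + (m + m)) with (y + m + m) in * by ring.
  set (v := I / 4 ^ S n) in *.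
  destruct (Rle_lt_dec v (Rabs (boundary_integral P Q x (x + l) y (y + m)))) as [K1|K1].
  { exists x, y. repeat split; auto; lra. }
  destruct (Rle_lt_dec v (Rabs (boundary_integral P Q (x + l) (x + l + l) y (y + m)))) as [K2|K2].
  { exists (x + l), y. repeat split; auto; lra. }
  destruct (Rle_lt_dec v (Rabs (boundary_integral P Q x (x + l) (y + m) (y + m + m)))) as [K3|K3].
  { exists x, (y + m). repeat split; auto; lra. }
  destruct (Rle_lt_dec v (Rabs (boundary_integral P Q (x + l) (x + l + l) (y + m) (y + m + m)))) as [K4|K4].
  { exists (x + l), (y + m). repeat split; auto; lra. }
  exfalso.
  apply Rabs_lt_between in K1. apply Rabs_lt_between in K2.
  apply Rabs_lt_between in K3. apply Rabs_lt_between in K4.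
  revert HB. apply Rlt_not_le. apply Rabs_lt_between. lra.
- unfold Bad. simpl. rewrite 3!Rdiv_1_r. unfold L, M.
  replace (a + (b - a)) with b by ring. replace (c + (d - c)) with d by ring.
  split; [lra | apply Rle_refl].
- set (T := L + M). assert (HT : 0 < T) by (unfold T, L, M; lra).
  (* With s = T / 2^n this [eta] turns the bound 4 eta s^2 into half of I / 4^n. *)
  destruct (boundary_integral_small x0 y0 (I / (8 * T ^ 2))) as (delta & Hdelta & Hsm).
  + unfold L in Hx0; lra.
  + unfold M in Hy0; lra.
  + apply Rdiv_lt_0_compat; [exact HI | nra].
  + destruct (pow_lt_1_zero (1 / 2) ltac:(rewrite Rabs_pos_eq; lra) (delta / T)
                (Rdiv_lt_0_compat _ _ Hdelta HT)) as [n Hpn].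
    specialize (Hpn n (Nat.le_refl n)).
    destruct (Hn n) as (x & y & [(Ha & Hb & Hc & Hd) HB] & _ & _ & _ & _ & Hx & Hy).
    assert (Hp : 0 < 2 ^ n) by (apply pow_lt; lra).
    assert (Hsz : T / 2 ^ n = L / 2 ^ n + M / 2 ^ n) by (unfold T; field; lra).
    assert (HposLn := HposL n). assert (HposMn := HposM n).
    specialize (Hsm x (L / 2 ^ n) y (M / 2 ^ n) (T / 2 ^ n)
      Ha Hb Hc Hd Hx Hy ltac:(lra) ltac:(lra)).
    assert (Hlt : T / 2 ^ n < delta).
    { rewrite Rabs_pos_eq in Hpn by (apply pow_le; lra).
      apply (Rmult_lt_compat_l T) in Hpn; [|exact HT].
      replace (T * (delta / T)) with delta in Hpn by (field; lra).
      replace (T * (1 / 2) ^ n) with (T / 2 ^ n) in Hpn; [exact Hpn|].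
      unfold Rdiv. rewrite Rmult_1_l, pow_inv. reflexivity. }
    specialize (Hsm Hlt).
    assert (H4 : 4 ^ n = 2 ^ n * 2 ^ n).
    { rewrite <- Rpow_mult_distr. f_equal; lra. }
    assert (Heq : 4 * (I / (8 * T ^ 2)) * (T / 2 ^ n) ^ 2 = I / 4 ^ n / 2).
    { rewrite H4. field. split; lra. }
    assert (0 < I / 4 ^ n) by (apply Rdiv_lt_0_compat; [exact HI | apply pow_lt; lra]).
    lra.
Qed.

End Goursat.

(** * Mean values of holomorphic functions *)

Lemma ex_derive_C_approx (f : C -> C) (z : C) :
  ex_derive (K := C_AbsRing) (V := C_NormedModule) f z ->
  exists l : C, forall eps, 0 < eps -> exists delta, 0 < delta /\
    forall w, Cmod (w - z) < delta ->
      Cmod (f w - f z - (w - z) * l) <= eps * Cmod (w - z).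
Proof.
intros [l [_ H]]. exists l. intros eps Heps.
specialize (H z (fun P HP => HP) (mkposreal eps Heps)).
destruct H as [delta Hdelta].
exists delta. split; [apply cond_pos|].
intros w Hw. exact (Hdelta w Hw).
Qed.

Lemma ex_derive_C_continuous (f : C -> C) (z : C) :
  ex_derive (K := C_AbsRing) (V := C_NormedModule) f z ->
  forall eps, 0 < eps -> exists delta, 0 < delta /\
    forall w, Cmod (w - z) < delta -> Cmod (f w - f z) < eps.
Proof.
intros Hf eps Heps. destruct (ex_derive_C_approx f z Hf) as [l Hl].
destruct (Hl 1 Rlt_0_1) as [d [Hd H]].
assert (Hc : 0 < eps / (2 + Cmod l)).
{ apply Rdiv_lt_0_compat; [exact Heps | generalize (Cmod_ge_0 l); lra]. }
exists (Rmin d (eps / (2 + Cmod l))). split; [apply Rmin_pos; assumption|].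
intros w Hw.
assert (H1 := H w (Rlt_le_trans _ _ _ Hw (Rmin_l _ _))).
assert (H2 := Rlt_le_trans _ _ _ Hw (Rmin_r _ _)).
replace (f w - f z)%C with ((f w - f z - (w - z) * l) + (w - z) * l)%C by ring.
eapply Rle_lt_trans; [apply Cmod_triangle|].
rewrite Cmod_mult. generalize (Cmod_ge_0 l) (Cmod_ge_0 (w - z)). intros Hl0 Hw0.
apply Rle_lt_trans with ((2 + Cmod l) * Cmod (w - z)); [nra|].
apply (Rmult_lt_compat_l (2 + Cmod l)) in H2; [|lra].
replace ((2 + Cmod l) * (eps / (2 + Cmod l))) with eps in H2 by (field; lra).
exact H2.
Qed.

Lemma Rabs_Re_le_Cmod (z : C) : Rabs (Re z) <= Cmod z.
Proof. eapply Rle_trans; [apply Rmax_l | apply Rmax_Cmod]. Qed.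

Lemma Rabs_Im_le_Cmod (z : C) : Rabs (Im z) <= Cmod z.
Proof. eapply Rle_trans; [apply Rmax_r | apply Rmax_Cmod]. Qed.

Lemma cauchy_riemann (f : C -> C) (x y : R) :
  ex_derive (K := C_AbsRing) (V := C_NormedModule) f (x, y) ->
  exists p q,
    differentiable_pt_lim (fun u v => Re (f (u, v))) x y p (- q) /\
    differentiable_pt_lim (fun u v => Im (f (u, v))) x y q p.
Proof.
intros Hf. destruct (ex_derive_C_approx f _ Hf) as [[p q] Hl].
exists p, q.
assert (Hk : forall eps : posreal, locally_2d (fun u v =>
  Cmod (f (u, v) - f (x, y) - ((u, v) - (x, y)) * (p, q)) <=
    eps * Rmax (Rabs (u - x)) (Rabs (v - y))) x y).
(* [differentiable_pt_lim] measures increments in the max norm; [Cmod] is at most sqrt 2 <= 2 times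
   that, hence the [eps / 2]. *)
{ intros eps. destruct (Hl (eps / 2)) as [d [Hd H]].
  { generalize (cond_pos eps); lra. }
  assert (Hd2 : 0 < d / 2) by lra.
  exists (mkposreal _ Hd2). intros u v Hu Hv. simpl in Hu, Hv.
  assert (Hm : Cmod ((u, v) - (x, y))%C <= 2 * Rmax (Rabs (u - x)) (Rabs (v - y))).
  { eapply Rle_trans; [apply Cmod_2Rmax|].
    apply Rmult_le_compat_r; [eapply Rle_trans; [apply Rabs_pos | apply Rmax_l]|].
    apply Rsqr_incr_0_var; [|lra]. rewrite Rsqr_sqrt by lra. unfold Rsqr; lra. }
  eapply Rle_trans; [apply H|].
  - eapply Rle_lt_trans; [exact Hm|].
    enough (Rmax (Rabs (u - x)) (Rabs (v - y)) < d / 2) by lra.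
    apply Rmax_lub_lt; assumption.
  - replace (eps * Rmax (Rabs (u - x)) (Rabs (v - y)))
      with (eps / 2 * (2 * Rmax (Rabs (u - x)) (Rabs (v - y)))) by field.
    apply Rmult_le_compat_l; [generalize (cond_pos eps); lra | exact Hm]. }
split; intros eps; destruct (Hk eps) as [d Hd]; exists d; intros u v Hu Hv;
  (eapply Rle_trans; [|exact (Hd u v Hu Hv)]);
  [ eapply Rle_trans; [|apply Rabs_Re_le_Cmod] | eapply Rle_trans; [|apply Rabs_Im_le_Cmod] ];
  right; f_equal; destruct (f (u, v)), (f (x, y)); simpl; ring.
Qed.

Lemma differentiable_pt_lim_mult_id (x y : R) :
  differentiable_pt_lim (fun u v => u * v) x y y x.
Proof.
intros eps. exists eps. intros u v Hu Hv.
replace (u * v - x * y - (y * (u - x) + x * (v - y))) with ((u - x) * (v - y)) by ring.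
rewrite Rabs_mult. apply Rmult_le_compat; try apply Rabs_pos; [lra | apply Rmax_r].
Qed.

Lemma differentiable_pt_lim_mult (f g : R -> R -> R) (x y fx fy gx gy : R) :
  differentiable_pt_lim f x y fx fy -> differentiable_pt_lim g x y gx gy ->
  differentiable_pt_lim (fun u v => f u v * g u v) x y
    (g x y * fx + f x y * gx) (g x y * fy + f x y * gy).
Proof.
intros Hf Hg.
exact (differentiable_pt_lim_comp (fun u v => u * v) f g x y _ _ _ _ _ _
  (differentiable_pt_lim_mult_id _ _) Hf Hg).
Qed.

Lemma differentiable_pt_lim_proj2 (f : R -> R) (x y l : R) :
  derivable_pt_lim f y l -> differentiable_pt_lim (fun _ v => f v) x y 0 l.
Proof.
intros H eps. destruct (differentiable_pt_lim_proj1_0 f y x l H eps) as [d Hd].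
exists d. intros u v Hu Hv. specialize (Hd v u Hv Hu). simpl in Hd.
rewrite Rmax_comm.
replace (f v - f y - (0 * (u - x) + l * (v - y)))
  with (f v - f y - (l * (v - y) + 0 * (u - x))) by ring.
exact Hd.
Qed.

Lemma Cmod_polar (r t : R) : 0 <= r -> Cmod (polar r t) = r.
Proof.
intros Hr. unfold Cmod, polar. simpl fst; simpl snd.
replace ((r * cos t) ^ 2 + (r * sin t) ^ 2) with (r ^ 2).
- apply sqrt_pow2; exact Hr.
- generalize (sin2_cos2 t). unfold Rsqr. intros H. nra.
Qed.

(* In polar coordinates the closed form [h dz / z] has imaginary part
   [Im h dr / r + Re h dt]. *)
Lemma polar_closed_form (h : C -> C) (r t : R) :
  0 < r < 1 -> holomorphic_on_disc h ->
  exists A B D,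
    differentiable_pt_lim (fun r t => Im (h (polar r t)) * / r) r t A B /\
    differentiable_pt_lim (fun r t => Re (h (polar r t))) r t B D.
Proof.
intros Hr Hh.
assert (Hz : in_disc (polar r t)) by (unfold in_disc; rewrite Cmod_polar; lra).
destruct (cauchy_riemann h (r * cos t) (r * sin t) (Hh _ Hz)) as (p & q & HRe & HIm).
assert (Hx : differentiable_pt_lim (fun r t => r * cos t) r t
               (cos t * 1 + r * 0) (cos t * 0 + r * - sin t)).
{ apply (differentiable_pt_lim_mult (fun r _ => r) (fun _ t => cos t)).
  - apply (differentiable_pt_lim_proj1_0 (fun r => r)), derivable_pt_lim_id.
  - apply differentiable_pt_lim_proj2, derivable_pt_lim_cos. }
assert (Hy : differentiable_pt_lim (fun r t => r * sin t) r t
               (sin t * 1 + r * 0) (sin t * 0 + r * cos t)).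
{ apply (differentiable_pt_lim_mult (fun r _ => r) (fun _ t => sin t)).
  - apply (differentiable_pt_lim_proj1_0 (fun r => r)), derivable_pt_lim_id.
  - apply differentiable_pt_lim_proj2, derivable_pt_lim_sin. }
assert (HQ := differentiable_pt_lim_comp _ _ _ r t _ _ _ _ _ _ HRe Hx Hy).
assert (HI := differentiable_pt_lim_comp _ _ _ r t _ _ _ _ _ _ HIm Hx Hy).
assert (Hinv : differentiable_pt_lim (fun r (_ : R) => / r) r t (- / r ^ 2) 0).
{ apply (differentiable_pt_lim_proj1_0 (fun r => / r)). apply is_derive_Reals.
  auto_derive; [lra | field; lra]. }
assert (HP := differentiable_pt_lim_mult _ _ r t _ _ _ _ HI Hinv). cbv beta in HP.
eexists. eexists. eexists. split; [exact HP|].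
(* Cauchy-Riemann in polar form: the t-derivative of Im h / r and the r-derivative of Re h are both
   p cos t - q sin t. *)
match goal with |- differentiable_pt_lim _ _ _ ?B _ =>
  replace B with (p * (cos t * 1 + r * 0) + - q * (sin t * 1 + r * 0)) by (field; lra)
end.
exact HQ.
Qed.

(** Goursat on s <= radius <= r, 0 <= t <= 2 PI: the sides t = 0 and t = 2 PI cancel by periodicity,
    so Re h has equal means on both circles. For small s the inner mean is close to Re h(0). The
    radius 0 itself is avoided because the form is singular there. *)
Lemma holomorphic_Re_max_circle (h : C -> C) (r M : R) :
  holomorphic_on_disc h -> 0 < r < 1 ->
  (forall t, 0 <= t <= 2 * PI -> Re (h (polar r t)) <= M) -> Re (h (RtoC 0)) <= M.
Proof.
intros Hh Hr HM. apply Rnot_lt_le. intros Hlt.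
(* Half the gap: on the small circle Re h exceeds M + eta, so the difference of the two integrands
   stays below -eta although its integral vanishes. *)
set (eta := (Re (h (RtoC 0)) - M) / 2).
assert (Heta : 0 < eta) by (unfold eta; lra).
destruct (ex_derive_C_continuous h (RtoC 0)) with (eps := eta) as [d [Hd Hcont]].
{ apply Hh. unfold in_disc. rewrite Cmod_0. lra. }
{ exact Heta. }
set (s := Rmin (d / 2) (r / 2)).
assert (Hs : 0 < s) by (apply Rmin_pos; lra).
assert (Hsd : s < d) by (generalize (Rmin_l (d / 2) (r / 2)); unfold s; lra).
assert (Hsr : s < r) by (generalize (Rmin_r (d / 2) (r / 2)); unfold s; lra).
set (P := fun r t => Im (h (polar r t)) * / r).
set (Q := fun r t => Re (h (polar r t))).
assert (Hpi := PI_RGT_0).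
assert (Hform : forall x y, s <= x <= r -> 0 <= y <= 2 * PI -> exists A B D,
  differentiable_pt_lim P x y A B /\ differentiable_pt_lim Q x y B D).
{ intros x y Hx _. apply polar_closed_form; [lra | exact Hh]. }
assert (G := goursat_rectangle P Q s r 0 (2 * PI) Hsr ltac:(lra) Hform).
unfold boundary_integral in G.
rewrite (RInt_ext (fun x => P x 0 - P x (2 * PI)) (fun _ => 0)) in G.
2:{ intros x _. unfold P, polar. rewrite cos_2PI, sin_2PI, cos_0, sin_0. apply Rminus_diag. }
rewrite RInt_const in G. unfold scal in G; simpl in G. unfold mult in G; simpl in G.
rewrite Rmult_0_r, Rplus_0_l in G.
assert (Hle : RInt (fun y => Q r y - Q s y) 0 (2 * PI) <= RInt (fun _ => - eta) 0 (2 * PI)).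
{ apply RInt_le; [lra | | apply ex_RInt_const |].
  - apply ex_RInt_Rminus; apply (ex_RInt_Q P Q s r 0 (2 * PI) Hform); lra.
  - intros t Ht. unfold Q.
    assert (H1 := HM t ltac:(lra)).
    assert (H2 : Cmod (h (polar s t) - h (RtoC 0)) < eta).
    { apply Hcont. replace (polar s t - 0)%C with (polar s t) by ring.
      rewrite Cmod_polar; lra. }
    assert (H3 := Rle_lt_trans _ _ _ (Rabs_Re_le_Cmod _) H2).
    apply Rabs_lt_between in H3.
    replace (Re (h (polar s t) - h (RtoC 0))%C)
      with (Re (h (polar s t)) - Re (h (RtoC 0))) in H3
      by (destruct (h (polar s t)), (h (RtoC 0)); simpl; ring).
    unfold eta in *. lra. }
rewrite G, RInt_const in Hle. unfold scal in Hle; simpl in Hle. unfold mult in Hle; simpl in Hle.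
nra.
Qed.

(** * Harmonic majorants of squared polynomials *)

(* [C_NormedModule] and [AbsRing_NormedModule C_AbsRing] carry different uniform
   structures but the same norm, and derivatives only see the norm of the target. *)
Lemma is_derive_C_AbsRing (f : C -> C) (z l : C) :
  is_derive (K := C_AbsRing) (V := C_NormedModule) f z l <->
  is_derive (K := C_AbsRing) (V := AbsRing_NormedModule C_AbsRing) f z l.
Proof.
split; intros [[H1 H2 H3] H4]; split; try exact H4; split; assumption.
Qed.

Lemma ex_derive_C_const (k z : C) :
  ex_derive (K := C_AbsRing) (V := C_NormedModule) (fun _ => k) z.
Proof. exists zero. apply (is_derive_const (V := C_NormedModule)). Qed.

Lemma ex_derive_C_id (z : C) :
  ex_derive (K := C_AbsRing) (V := C_NormedModule) (fun w => w) z.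
Proof. exists one. apply is_derive_C_AbsRing. apply (is_derive_id (K := C_AbsRing)). Qed.

Lemma ex_derive_C_plus (f g : C -> C) (z : C) :
  ex_derive (K := C_AbsRing) (V := C_NormedModule) f z ->
  ex_derive (K := C_AbsRing) (V := C_NormedModule) g z ->
  ex_derive (K := C_AbsRing) (V := C_NormedModule) (fun w => (f w + g w)%C) z.
Proof. apply (ex_derive_plus (V := C_NormedModule) f g z). Qed.

Lemma ex_derive_C_mult (f g : C -> C) (z : C) :
  ex_derive (K := C_AbsRing) (V := C_NormedModule) f z ->
  ex_derive (K := C_AbsRing) (V := C_NormedModule) g z ->
  ex_derive (K := C_AbsRing) (V := C_NormedModule) (fun w => (f w * g w)%C) z.
Proof.
intros [lf Hf] [lg Hg]. apply is_derive_C_AbsRing in Hf, Hg.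
eexists. apply is_derive_C_AbsRing.
apply (is_derive_mult (K := C_AbsRing) f g z lf lg Hf Hg Cmult_comm).
Qed.

(** Degree N inclusive. Peeling off the constant term and shifting the coefficients lets [energy]
    follow the same recursion. *)
Fixpoint horner_sum (N : nat) (a : nat -> C) (w : C) : C :=
  match N with
  | O => a 0%nat
  | S N => (a 0%nat + w * horner_sum N (fun n => a (S n)) w)%C
  end.

(* A polynomial in [w] with [|horner_sum N a w|^2] as real part when [|w|^2 = rho]. *)
Fixpoint energy (rho : R) (N : nat) (a : nat -> C) (w : C) : C :=
  match N with
  | O => RtoC (Cmod (a 0%nat) ^ 2)
  | S N => (RtoC (Cmod (a 0%nat) ^ 2)
            + RtoC 2 * Cconj (a 0%nat) * (w * horner_sum N (fun n => a (S n)) w)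
            + RtoC rho * energy rho N (fun n => a (S n)) w)%C
  end.

Lemma Cmod_sqr (z : C) : Cmod z ^ 2 = fst z ^ 2 + snd z ^ 2.
Proof. apply pow2_sqrt. nra. Qed.

(** With p the shifted polynomial, |a_0 + w p|^2 = |a_0|^2 + 2 Re(conj(a_0) w p) + |w|^2 |p|^2;
    [energy] replaces the last term by rho times the energy of p. *)
Lemma energy_S (rho : R) (N : nat) (a : nat -> C) (w : C) :
  Re (energy rho (S N) a w) =
    Cmod (horner_sum (S N) a w) ^ 2
    - Cmod w ^ 2 * Cmod (horner_sum N (fun n => a (S n)) w) ^ 2
    + rho * Re (energy rho N (fun n => a (S n)) w).
Proof.
cbn [energy horner_sum]. rewrite !Cmod_sqr.
generalize (horner_sum N (fun n => a (S n)) w) (energy rho N (fun n => a (S n)) w).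
intros p e. destruct (a 0%nat), w, p, e. simpl. ring.
Qed.

Lemma Re_energy_ge (rho : R) (N : nat) (a : nat -> C) (w : C) :
  Cmod w ^ 2 <= rho -> Cmod (horner_sum N a w) ^ 2 <= Re (energy rho N a w).
Proof.
intros Hw. revert a. induction N as [|N IH]; intros a.
- simpl. lra.
- rewrite energy_S. specialize (IH (fun n => a (S n))).
  generalize (pow2_ge_0 (Cmod (horner_sum N (fun n => a (S n)) w))) (pow2_ge_0 (Cmod w)).
  nra.
Qed.

Lemma Re_energy_circle (rho : R) (N : nat) (a : nat -> C) (w : C) :
  Cmod w ^ 2 = rho -> Re (energy rho N a w) = Cmod (horner_sum N a w) ^ 2.
Proof.
intros Hw. revert a. induction N as [|N IH]; intros a.
- reflexivity.
- rewrite energy_S, IH, Hw. ring.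
Qed.

Lemma sum_f_R0_shift (u : nat -> R) (N : nat) :
  sum_f_R0 u (S N) = u 0%nat + sum_f_R0 (fun n => u (S n)) N.
Proof. apply (decomp_sum u (S N)). lia. Qed.

(** Combined with [Re_energy_circle] and the mean value property, this is Parseval's identity for a
    polynomial on the circle |z|^2 = rho. *)
Lemma Re_energy_0 (rho : R) (N : nat) (a : nat -> C) :
  Re (energy rho N a (RtoC 0)) = sum_f_R0 (fun n => Cmod (a n) ^ 2 * rho ^ n) N.
Proof.
revert a. induction N as [|N IH]; intros a.
- simpl. ring.
- rewrite energy_S, IH, sum_f_R0_shift, Cmod_0. cbn [horner_sum].
  rewrite Cmult_0_l, Cplus_0_r, scal_sum. f_equal; [simpl; ring|].
  apply sum_eq. intros n _. simpl. ring.
Qed.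

(** Sum 2 A |b_n| |w|^n <= (A^2 + |b_n|^2) |w|^n over n. The full geometric series stands in for the
    finite one so that the induction closes. *)
Lemma young_horner_sum (N : nat) (b : nat -> C) (w : C) (A : R) :
  Cmod w < 1 ->
  2 * A * Cmod (horner_sum N b w) <=
    A ^ 2 / (1 - Cmod w) + sum_f_R0 (fun n => Cmod (b n) ^ 2 * Cmod w ^ n) N.
Proof.
intros Hw. assert (Hw0 := Cmod_ge_0 w). set (x := Cmod w) in *.
destruct (Rle_lt_dec A 0) as [HA|HA].
{ assert (0 <= A ^ 2 / (1 - x)) by (apply Rdiv_le_0_compat; [nra | lra]).
  assert (0 <= sum_f_R0 (fun n => Cmod (b n) ^ 2 * x ^ n) N).
  { apply cond_pos_sum. intros n. apply Rmult_le_pos; [apply pow2_ge_0 | apply pow_le; lra]. }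
  generalize (Cmod_ge_0 (horner_sum N b w)). nra. }
revert b. induction N as [|N IH]; intros b.
- simpl. apply Rle_trans with (A ^ 2 + Cmod (b 0%nat) ^ 2).
  + generalize (pow2_ge_0 (A - Cmod (b 0%nat))). simpl. nra.
  + assert (A ^ 2 / (1 - x) = A ^ 2 + A ^ 2 * x / (1 - x)) by (field; lra).
    assert (0 <= A ^ 2 * x / (1 - x)) by (apply Rdiv_le_0_compat; [nra | lra]).
    simpl in *. lra.
- rewrite sum_f_R0_shift. specialize (IH (fun n => b (S n))).
  set (p := horner_sum N (fun n => b (S n)) w) in *.
  set (T := sum_f_R0 (fun n => Cmod (b (S n)) ^ 2 * x ^ n) N) in *.
  assert (HT : sum_f_R0 (fun n => Cmod (b (S n)) ^ 2 * x ^ S n) N = x * T).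
  { unfold T. rewrite scal_sum. apply sum_eq. intros n _. simpl. ring. }
  rewrite HT.
  assert (Hm : Cmod (horner_sum (S N) b w) <= Cmod (b 0%nat) + x * Cmod p).
  { unfold x. rewrite <- Cmod_mult. apply Cmod_triangle. }
  (* The geometric sum reproduces itself: A^2 pairs with the new constant term, and x times the rest
     with the induction hypothesis. *)
  assert (A ^ 2 / (1 - x) = A ^ 2 + x * (A ^ 2 / (1 - x))) by (field; lra).
  generalize (pow2_ge_0 (A - Cmod (b 0%nat))). simpl pow at 3. nra.
Qed.

(** For rho = 1 the real part is the sum of |a_n|^2 plus twice that of Re(conj(a_i) a_j w^(j-i))
    over i < j. Splitting each product evenly gives |a_n|^2 at most the weight sum over j >= 0 of
    |w|^|n-j|. Over all integers j this would be (1+|w|)/(1-|w|); the subtracted term is the missing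
    part j < 0. *)
Lemma Re_energy_le (N : nat) (a : nat -> C) (w : C) :
  Cmod w < 1 ->
  Re (energy 1 N a w) <=
    sum_f_R0 (fun n => Cmod (a n) ^ 2 *
      ((1 + Cmod w) / (1 - Cmod w) - Cmod w ^ S n / (1 - Cmod w))) N.
Proof.
intros Hw. assert (Hw0 := Cmod_ge_0 w).
revert a. induction N as [|N IH]; intros a.
- cbn [sum_f_R0 energy]. set (A := Cmod (a 0%nat)).
  replace (A ^ 2 * ((1 + Cmod w) / (1 - Cmod w) - Cmod w ^ 1 / (1 - Cmod w)))
    with (A ^ 2 + A ^ 2 * Cmod w / (1 - Cmod w)) by (field; lra).
  assert (0 <= A ^ 2 * Cmod w / (1 - Cmod w)) by (apply Rdiv_le_0_compat; nra).
  change (Re (RtoC (A ^ 2))) with (A ^ 2). lra.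
- rewrite sum_f_R0_shift. specialize (IH (fun n => a (S n))). cbn [energy].
  set (p := horner_sum N (fun n => a (S n)) w) in *.
  set (e := energy 1 N (fun n => a (S n)) w) in *.
  assert (HY := young_horner_sum N (fun n => a (S n)) w (Cmod (a 0%nat)) Hw). fold p in HY.
  set (A := Cmod (a 0%nat)) in *.
  set (T := sum_f_R0 (fun n => Cmod (a (S n)) ^ 2 * Cmod w ^ n) N) in *.
  assert (HR : Re (RtoC (A ^ 2) + RtoC 2 * Cconj (a 0%nat) * (w * p) + RtoC 1 * e)%C
               <= A ^ 2 + Cmod w * (2 * A * Cmod p) + Re e).
  { assert (H := Rabs_Re_le_Cmod (Cconj (a 0%nat) * (w * p))%C).
    rewrite !Cmod_mult, Cmod_conj in H. fold A in H. apply Rabs_le_between in H.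
    replace (Re (RtoC (A ^ 2) + RtoC 2 * Cconj (a 0%nat) * (w * p) + RtoC 1 * e)%C)
      with (A ^ 2 + 2 * Re (Cconj (a 0%nat) * (w * p))%C + Re e).
    - lra.
    - destruct (a 0%nat), w, p, e. simpl. ring. }
  eapply Rle_trans; [exact HR|].
  apply (Rmult_le_compat_l (Cmod w)) in HY; [|lra].
  set (U := sum_f_R0 (fun n => Cmod (a (S n)) ^ 2 *
      ((1 + Cmod w) / (1 - Cmod w) - Cmod w ^ S n / (1 - Cmod w))) N) in *.
  (* Shifting the index raises the weight of |a_(n+1)|^2 by |w|^(n+1), exactly what the cross terms
     with a_0 contribute. *)
  assert (HS : sum_f_R0 (fun n => Cmod (a (S n)) ^ 2 *
      ((1 + Cmod w) / (1 - Cmod w) - Cmod w ^ S (S n) / (1 - Cmod w))) N = U + Cmod w * T).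
  { unfold U, T. rewrite scal_sum, <- sum_plus. apply sum_eq. intros n _. simpl. field. lra. }
  rewrite HS.
  replace (A ^ 2 * ((1 + Cmod w) / (1 - Cmod w) - Cmod w ^ 1 / (1 - Cmod w)))
    with (A ^ 2 + Cmod w * (A ^ 2 / (1 - Cmod w))) by (field; lra).
  lra.
Qed.

Lemma ex_derive_horner_sum (N : nat) (a : nat -> C) (h : C -> C) (z : C) :
  ex_derive (K := C_AbsRing) (V := C_NormedModule) h z ->
  ex_derive (K := C_AbsRing) (V := C_NormedModule) (fun w => horner_sum N a (h w)) z.
Proof.
intros Hh. revert a. induction N as [|N IH]; intros a; simpl.
- apply ex_derive_C_const.
- apply ex_derive_C_plus; [apply ex_derive_C_const|].
  apply ex_derive_C_mult; [exact Hh | apply IH].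
Qed.

Lemma ex_derive_energy (rho : R) (N : nat) (a : nat -> C) (h : C -> C) (z : C) :
  ex_derive (K := C_AbsRing) (V := C_NormedModule) h z ->
  ex_derive (K := C_AbsRing) (V := C_NormedModule) (fun w => energy rho N a (h w)) z.
Proof.
intros Hh. revert a. induction N as [|N IH]; intros a; simpl.
- apply ex_derive_C_const.
- apply ex_derive_C_plus; [apply ex_derive_C_plus; [apply ex_derive_C_const|]|].
  + apply ex_derive_C_mult; [apply ex_derive_C_const|].
    apply ex_derive_C_mult; [exact Hh | apply ex_derive_horner_sum, Hh].
  + apply ex_derive_C_mult; [apply ex_derive_C_const | apply IH].
Qed.

Lemma sum_n_horner_sum (N : nat) (a : nat -> C) (z : C) :
  sum_n (G := C_AbelianMonoid) (fun n => (a n * Defs.Cpow z n)%C) N = horner_sum N a z.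
Proof.
revert a. induction N as [|N IH]; intros a.
- rewrite sum_O. unfold Defs.Cpow. simpl. unfold one; simpl. apply Cmult_1_r.
- cbn [horner_sum]. rewrite <- IH. unfold sum_n at 1.
  rewrite sum_Sn_m by lia. rewrite <- sum_n_m_S.
  rewrite <- (sum_n_mult_l (K := C_Ring)). unfold sum_n, plus; simpl. f_equal.
  + unfold Defs.Cpow. simpl. unfold one; simpl. apply Cmult_1_r.
  + apply sum_n_m_ext. intros n. unfold Defs.Cpow, mult; simpl. unfold mult; simpl. ring.
Qed.

(** * Power series on circles *)

(** A geometric tail estimate; the factor 1 - q^k is kept so that induction on k closes. *)
Lemma horner_sum_cauchy (a : nat -> C) (z : C) (K q : R) (N k : nat) :
  0 <= q < 1 -> (forall n, Cmod (a n * Defs.Cpow z n) <= K * q ^ n) ->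
  Cmod (horner_sum (N + k) a z - horner_sum N a z) <= K * q ^ N * (1 - q ^ k) / (1 - q).
Proof.
intros Hq Ha.
assert (HK : 0 <= K).
{ generalize (Ha 0%nat) (Cmod_ge_0 (a 0%nat * Defs.Cpow z 0)). simpl. lra. }
induction k as [|k IH].
- rewrite Nat.add_0_r.
  replace (horner_sum N a z - horner_sum N a z)%C with (RtoC 0) by ring.
  rewrite Cmod_0. right. simpl. field. lra.
- rewrite Nat.add_succ_r, <- !sum_n_horner_sum, sum_Sn, !sum_n_horner_sum.
  change (plus (horner_sum (N + k) a z) (a (S (N + k)) * Defs.Cpow z (S (N + k)))%C)
    with (horner_sum (N + k) a z + a (S (N + k)) * Defs.Cpow z (S (N + k)))%C.
  set (u := (a (S (N + k)) * Defs.Cpow z (S (N + k)))%C).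
  replace (horner_sum (N + k) a z + u - horner_sum N a z)%C
    with (horner_sum (N + k) a z - horner_sum N a z + u)%C by ring.
  eapply Rle_trans; [apply Cmod_triangle|].
  assert (Hu := Ha (S (N + k))). fold u in Hu.
  assert (Hqk : q ^ S (N + k) <= q ^ N * q ^ k).
  { simpl. rewrite pow_add.
    assert (0 <= q ^ N * q ^ k) by (apply Rmult_le_pos; apply pow_le; lra). nra. }
  apply (Rmult_le_compat_l K) in Hqk; [|exact HK].
  replace (K * q ^ N * (1 - q ^ S k) / (1 - q))
    with (K * q ^ N * (1 - q ^ k) / (1 - q) + K * (q ^ N * q ^ k)) by (simpl; field; lra).
  lra.
Qed.

Lemma is_series_C_approx (u : nat -> C) (l : C) :
  is_series (K := C_AbsRing) (V := C_NormedModule) u l ->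
  forall eps, 0 < eps -> exists N0, forall n, (N0 <= n)%nat ->
    Cmod (sum_n (G := C_AbelianMonoid) u n - l) < eps.
Proof.
intros H eps Heps.
(* Balls of [C] are products of real balls; passing to [Cmod] costs a factor sqrt 2. *)
assert (Hs := sqrt_lt_R0 2 ltac:(lra)).
assert (He : 0 < eps / sqrt 2) by (apply Rdiv_lt_0_compat; assumption).
destruct (H _ (locally_ball (l : C_UniformSpace) (mkposreal _ He))) as [N0 HN0].
exists N0. intros n Hn.
assert (Hb := C_NormedModule_mixin_compat2 _ _ _ (HN0 n Hn)). simpl in Hb.
replace (sqrt 2 * (eps / sqrt 2)) with eps in Hb by (field; lra).
exact Hb.
Qed.

Lemma Cmod_Cpow (z : C) (n : nat) : Cmod (Defs.Cpow z n) = Cmod z ^ n.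
Proof.
unfold Defs.Cpow. induction n as [|n IH]; simpl.
- apply Cmod_1.
- unfold mult; simpl. rewrite Cmod_mult, IH. reflexivity.
Qed.

(** Convergence at a point s between r and 1 bounds |c_n| s^n, so the terms on |z| <= r decay like
    (r/s)^n. *)
Lemma taylor_coeffs_geometric (g : C -> C) (c : nat -> C) (r : R) :
  taylor_coeffs g c -> 0 <= r < 1 ->
  exists K q, 0 <= q < 1 /\
    forall z n, Cmod z <= r -> Cmod (c n * Defs.Cpow z n) <= K * q ^ n.
Proof.
intros Hc Hr. set (s := (1 + r) / 2).
assert (Hs : 0 < s < 1) by (unfold s; lra).
assert (Hcs : Cmod (RtoC s) = s) by (rewrite Cmod_R; apply Rabs_pos_eq; lra).
assert (Hdisc : in_disc (RtoC s)) by (unfold in_disc; lra).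
destruct (filterlim_bounded (V := C_NormedModule)
  (sum_n (fun n => (c n * Defs.Cpow (RtoC s) n)%C))) as [B HB].
{ exists (g (RtoC s)). exact (Hc _ Hdisc). }
assert (HB0 : 0 <= B).
{ eapply Rle_trans; [apply (norm_ge_0 (V := C_NormedModule)) | exact (HB 0%nat)]. }
(* Each term is a difference of consecutive partial sums, all bounded by [B]. *)
assert (Hterm : forall n, Cmod (c n) * s ^ n <= 2 * B).
{ intros n. rewrite <- Hcs at 1. rewrite <- Cmod_Cpow, <- Cmod_mult.
  destruct n as [|n].
  - specialize (HB 0%nat). rewrite sum_O in HB. change (Cmod (c 0%nat * Defs.Cpow s 0) <= B) in HB.
    lra.
  - assert (H1 := HB (S n)). assert (H2 := HB n). rewrite sum_Sn in H1.
    change (Cmod (sum_n (G := C_AbelianMonoid) (fun n => (c n * Defs.Cpow s n)%C) n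
                  + c (S n) * Defs.Cpow s (S n)) <= B) in H1.
    change (Cmod (sum_n (G := C_AbelianMonoid) (fun n => (c n * Defs.Cpow s n)%C) n) <= B) in H2.
    set (S0 := sum_n (G := C_AbelianMonoid) (fun n => (c n * Defs.Cpow s n)%C) n) in *.
    set (u := (c (S n) * Defs.Cpow s (S n))%C) in *.
    replace u with ((S0 + u) + - S0)%C by ring.
    eapply Rle_trans; [apply Cmod_triangle|]. rewrite Cmod_opp. lra. }
exists (2 * B), (r / s). split.
- split; [apply Rdiv_le_0_compat; lra|].
  apply Rmult_lt_reg_r with s; [lra|]. unfold Rdiv.
  rewrite Rmult_assoc, Rinv_l by lra. unfold s; lra.
- intros z n Hz. rewrite Cmod_mult, Cmod_Cpow.
  apply Rle_trans with (Cmod (c n) * r ^ n).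
  + apply Rmult_le_compat_l; [apply Cmod_ge_0 | apply pow_incr; split; [apply Cmod_ge_0 | exact Hz]].
  + replace (Cmod (c n) * r ^ n) with (Cmod (c n) * s ^ n * (r / s) ^ n).
    * apply Rmult_le_compat_r; [apply pow_le, Rdiv_le_0_compat; lra | apply Hterm].
    * rewrite Rmult_assoc, <- Rpow_mult_distr. do 2 f_equal. field. lra.
Qed.

Lemma taylor_coeffs_truncation (g : C -> C) (c : nat -> C) (r : R) :
  taylor_coeffs g c -> 0 <= r < 1 ->
  exists K q, 0 <= q < 1 /\
    forall z N, Cmod z <= r -> Cmod (g z - horner_sum N c z) <= K * q ^ N.
Proof.
intros Hc Hr. destruct (taylor_coeffs_geometric g c r Hc Hr) as (K & q & Hq & HK).
exists (K / (1 - q)), q. split; [exact Hq|].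
intros z N Hz. apply le_epsilon. intros eps Heps.
assert (Hdisc : in_disc z) by (unfold in_disc; lra).
destruct (is_series_C_approx _ _ (Hc z Hdisc) eps Heps) as [N0 HN0].
specialize (HN0 (N + N0)%nat ltac:(lia)). rewrite sum_n_horner_sum in HN0.
assert (HC := horner_sum_cauchy c z K q N N0 Hq (fun n => HK z n Hz)).
set (p := horner_sum (N + N0) c z) in *.
replace (g z - horner_sum N c z)%C with ((p - horner_sum N c z) + - (p - g z))%C by ring.
eapply Rle_trans; [apply Cmod_triangle|]. rewrite Cmod_opp.
apply Rplus_le_compat; [|lra]. eapply Rle_trans; [exact HC|].
replace (K / (1 - q) * q ^ N) with (K * q ^ N * 1 / (1 - q)) by (field; lra).
assert (HK0 : 0 <= K).
{ generalize (HK z 0%nat Hz) (Cmod_ge_0 (c 0%nat * Defs.Cpow z 0)). simpl. lra. }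
apply Rmult_le_compat_r; [left; apply Rinv_0_lt_compat; lra|].
apply Rmult_le_compat_l; [apply Rmult_le_pos; [exact HK0 | apply pow_le; lra]|].
generalize (pow_le q N0 ltac:(lra)). lra.
Qed.

Lemma taylor_coeffs_Cmod_sqr (g : C -> C) (c : nat -> C) (r eps : R) :
  taylor_coeffs g c -> 0 <= r < 1 -> 0 < eps ->
  exists N0, forall N z, (N0 <= N)%nat -> Cmod z <= r ->
    Rabs (Cmod (g z) ^ 2 - Cmod (horner_sum N c z) ^ 2) <= eps.
Proof.
intros Hc Hr Heps.
destruct (taylor_coeffs_truncation g c r Hc Hr) as (K & q & Hq & HK).
assert (HK0 : 0 <= K).
{ assert (H := HK (RtoC 0) 0%nat ltac:(rewrite Cmod_0; lra)).
  generalize (Cmod_ge_0 (g (RtoC 0) - horner_sum 0 c (RtoC 0))). simpl in *. lra. }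
(* Bounds |g| + |p|, since |g| <= |c_0| + K and |p| <= |g| + K; the extra 1, as in [K + 1] below,
   avoids division by zero. *)
set (B := 2 * (Cmod (c 0%nat) + K) + K + 1).
assert (HB : 0 < B) by (unfold B; generalize (Cmod_ge_0 (c 0%nat)); lra).
assert (Hpos : 0 < eps / (B * (K + 1))).
{ apply Rdiv_lt_0_compat; [exact Heps | apply Rmult_lt_0_compat; lra]. }
destruct (pow_lt_1_zero q ltac:(rewrite Rabs_pos_eq; lra) _ Hpos) as [N0 HN0].
exists N0. intros N z HN Hz.
specialize (HN0 N HN). rewrite Rabs_pos_eq in HN0 by (apply pow_le; lra).
assert (HqN : 0 <= q ^ N <= 1).
{ split; [apply pow_le; lra|]. rewrite <- (pow1 N). apply pow_incr. lra. }
assert (Hd := HK z N Hz).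
assert (Hg : Cmod (g z) <= Cmod (c 0%nat) + K).
{ assert (H := HK z 0%nat Hz). simpl in H. rewrite Rmult_1_r in H.
  replace (g z) with ((g z - c 0%nat) + c 0%nat)%C by ring.
  eapply Rle_trans; [apply Cmod_triangle|]. lra. }
set (p := horner_sum N c z) in *.
assert (Hp : Cmod p <= Cmod (g z) + K).
{ replace p with (g z + - (g z - p))%C by ring.
  eapply Rle_trans; [apply Cmod_triangle|]. rewrite Cmod_opp. nra. }
assert (Hdiff : Rabs (Cmod (g z) - Cmod p) <= K * q ^ N).
{ eapply Rle_trans; [exact (norm_triangle_inv (V := C_NormedModule) (g z) p) | exact Hd]. }
replace (Cmod (g z) ^ 2 - Cmod p ^ 2)
  with ((Cmod (g z) - Cmod p) * (Cmod (g z) + Cmod p)) by ring.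
rewrite Rabs_mult.
assert (Hsum : Rabs (Cmod (g z) + Cmod p) <= B).
{ generalize (Cmod_ge_0 (g z)) (Cmod_ge_0 p). intros. rewrite Rabs_pos_eq by lra.
  unfold B. lra. }
apply Rle_trans with (K * q ^ N * B).
- apply Rmult_le_compat; try apply Rabs_pos; assumption.
- apply (Rmult_lt_compat_l (B * (K + 1))) in HN0; [|apply Rmult_lt_0_compat; lra].
  replace (B * (K + 1) * (eps / (B * (K + 1)))) with eps in HN0 by (field; lra).
  nra.
Qed.

(** On the circle the energy of a truncation of g equals its squared modulus, hence exceeds Re G by
    at most eps. The maximum principle carries this to 0, where the energy is the coefficient
    sum. *)
Lemma bessel_majorant (g G : C -> C) (c : nat -> C) (r : R) (K : nat) :
  taylor_coeffs g c -> holomorphic_on_disc G -> 0 < r < 1 ->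
  (forall t, 0 <= t <= 2 * PI -> Cmod (g (polar r t)) ^ 2 <= Re (G (polar r t))) ->
  sum_f_R0 (fun n => Cmod (c n) ^ 2 * (r ^ 2) ^ n) K <= Re (G (RtoC 0)).
Proof.
intros Hc HG Hr HgG. apply le_epsilon. intros eps Heps.
destruct (taylor_coeffs_Cmod_sqr g c r eps Hc ltac:(lra) Heps) as [N0 HN0].
(* At least [N0] for the approximation, and at least [K] so that the wanted partial sum is contained
   in the one obtained. *)
set (N := (N0 + K)%nat).
set (h := fun z => (energy (r ^ 2) N c z + RtoC (-1) * G z)%C).
assert (Hh : Re (h (RtoC 0)) <= eps).
{ apply (holomorphic_Re_max_circle h r eps); [|exact Hr|].
  - intros z Hz. apply ex_derive_C_plus.
    + apply (ex_derive_energy _ _ _ (fun w => w)), ex_derive_C_id.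
    + apply ex_derive_C_mult; [apply ex_derive_C_const | exact (HG z Hz)].
  - intros t Ht. specialize (HgG t Ht).
    assert (Hm : Cmod (polar r t) = r) by (apply Cmod_polar; lra).
    specialize (HN0 N (polar r t) ltac:(unfold N; lia) ltac:(lra)).
    apply Rabs_le_between in HN0.
    assert (He := Re_energy_circle (r ^ 2) N c (polar r t) ltac:(rewrite Hm; reflexivity)).
    unfold h.
    replace (Re (energy (r ^ 2) N c (polar r t) + RtoC (-1) * G (polar r t))%C)
      with (Re (energy (r ^ 2) N c (polar r t)) - Re (G (polar r t)))
      by (generalize (energy (r ^ 2) N c (polar r t)) (G (polar r t)); intros [] []; simpl; ring).
    lra. }
unfold h in Hh.
replace (Re (energy (r ^ 2) N c (RtoC 0) + RtoC (-1) * G (RtoC 0))%C)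
  with (Re (energy (r ^ 2) N c (RtoC 0)) - Re (G (RtoC 0))) in Hh
  by (generalize (energy (r ^ 2) N c (RtoC 0)) (G (RtoC 0)); intros [] []; simpl; ring).
rewrite Re_energy_0 in Hh.
apply Rle_trans with (sum_f_R0 (fun n => Cmod (c n) ^ 2 * (r ^ 2) ^ n) N); [|lra].
assert (Hinc : forall k, sum_f_R0 (fun n => Cmod (c n) ^ 2 * (r ^ 2) ^ n) K <=
                         sum_f_R0 (fun n => Cmod (c n) ^ 2 * (r ^ 2) ^ n) (k + K)).
{ induction k as [|k IH]; [apply Rle_refl|]. simpl (S k + K)%nat. rewrite tech5.
  assert (0 <= Cmod (c (S (k + K))) ^ 2 * (r ^ 2) ^ S (k + K)).
  { apply Rmult_le_pos; [apply pow2_ge_0 | apply pow_le, pow2_ge_0]. }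
  lra. }
apply Hinc.
Qed.

(** Zero is itself a majorant of |g|^2, so [bessel_majorant] on a single circle kills every
    coefficient. *)
Lemma taylor_coeffs_zero (g : C -> C) (c : nat -> C) :
  taylor_coeffs g c -> (forall z, in_disc z -> g z = RtoC 0) -> forall n, c n = RtoC 0.
Proof.
intros Hc Hg n. apply Cmod_eq_0.
assert (H := bessel_majorant g (fun _ => RtoC 0) c (1 / 2) n Hc).
assert (Hs : sum_f_R0 (fun n => Cmod (c n) ^ 2 * ((1 / 2) ^ 2) ^ n) n <= 0).
{ apply H; [|lra|].
  - intros z _. apply ex_derive_C_const.
  - intros t _. rewrite Hg.
    + rewrite Cmod_0. simpl. lra.
    + unfold in_disc. rewrite Cmod_polar; lra. }
assert (Hpos : forall k, 0 <= Cmod (c k) ^ 2 * ((1 / 2) ^ 2) ^ k).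
{ intros k. apply Rmult_le_pos; [apply pow2_ge_0 | apply pow_le; lra]. }
assert (Hn : Cmod (c n) ^ 2 * ((1 / 2) ^ 2) ^ n <= 0).
{ destruct n as [|n]; [exact Hs|].
  rewrite tech5 in Hs.
  assert (H0 := cond_pos_sum _ n Hpos). lra. }
assert (0 < ((1 / 2) ^ 2) ^ n) by (apply pow_lt; lra).
assert (Cmod (c n) ^ 2 <= 0) by nra.
generalize (Cmod_ge_0 (c n)). nra.
Qed.

(** * Littlewood subordination with a defect term *)

(** Truncations of f converge uniformly only on discs of radius s < 1, so the image of the circle
    must be confined to one; |phi| attains its maximum there. *)
Lemma holomorphic_circle_compact (phi : C -> C) (r : R) :
  holomorphic_on_disc phi -> (forall z, in_disc z -> in_disc (phi z)) -> 0 < r < 1 ->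
  exists s, 0 <= s < 1 /\ forall t, 0 <= t <= 2 * PI -> Cmod (phi (polar r t)) <= s.
Proof.
intros Hphi Hself Hr. assert (Hpi := PI_RGT_0).
assert (Hin : forall t, in_disc (polar r t)).
{ intros t. unfold in_disc. rewrite Cmod_polar; lra. }
destruct (continuity_ab_maj (fun t => Cmod (phi (polar r t))) 0 (2 * PI)) as [t0 [Hmax _]].
- lra.
- intros t _.
  assert (Hpolar : continuity_pt (fun t => r * cos t) t /\ continuity_pt (fun t => r * sin t) t).
  { split; apply derivable_continuous_pt; apply derivable_pt_scal;
      [apply derivable_pt_cos | apply derivable_pt_sin]. }
  apply continuity_pt_locally. intros eps.
  destruct (ex_derive_C_continuous phi _ (Hphi _ (Hin t)) eps (cond_pos eps)) as [d [Hd Hc]].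
  assert (Hd2 : 0 < d / 2) by lra.
  destruct Hpolar as [Hcos Hsin].
  assert (Hcos' := proj1 (continuity_pt_locally _ _) Hcos (mkposreal _ Hd2)).
  assert (Hsin' := proj1 (continuity_pt_locally _ _) Hsin (mkposreal _ Hd2)).
  generalize (filter_and _ _ Hcos' Hsin'). apply filter_imp. simpl. intros u [Hu1 Hu2].
  eapply Rle_lt_trans.
  { exact (norm_triangle_inv (V := C_NormedModule) (phi (polar r u)) (phi (polar r t))). }
  apply Hc. eapply Rle_lt_trans; [apply Cmod_2Rmax|].
  apply Rle_lt_trans with (2 * Rmax (Rabs (r * cos u - r * cos t)) (Rabs (r * sin u - r * sin t))).
  + apply Rmult_le_compat_r; [eapply Rle_trans; [apply Rabs_pos | apply Rmax_l]|].
    apply Rsqr_incr_0_var; [|lra]. rewrite Rsqr_sqrt by lra. unfold Rsqr; lra.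
  + enough (Rmax (Rabs (r * cos u - r * cos t)) (Rabs (r * sin u - r * sin t)) < d / 2) by lra.
    apply Rmax_lub_lt; assumption.
- exists (Cmod (phi (polar r t0))). split; [|exact Hmax].
  split; [apply Cmod_ge_0 | exact (Hself _ (Hin t0))].
Qed.

Lemma sum_f_R0_ge_term (u : nat -> R) (m k : nat) :
  (forall n, 0 <= u n) -> u m <= sum_f_R0 u (k + m).
Proof.
intros Hu. induction k as [|k IH].
- destruct m as [|m]; [apply Rle_refl|].
  simpl. generalize (cond_pos_sum u m Hu). lra.
- simpl. generalize (Hu (S (k + m))). lra.
Qed.

Lemma sum_f_R0_le_Series (u : nat -> R) (N : nat) :
  (forall n, 0 <= u n) -> ex_series u -> sum_f_R0 u N <= Series u.
Proof.
intros Hu Hex. rewrite <- sum_n_Reals.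
apply (is_lim_seq_incr_compare (sum_n u) (Series u)).
- exact (Series_correct u Hex).
- intros n. rewrite sum_Sn. unfold plus; simpl. specialize (Hu (S n)). lra.
Qed.

Lemma Series_le_bound (u : nat -> R) (B : R) :
  ex_series u -> (forall N, sum_f_R0 u N <= B) -> Series u <= B.
Proof.
intros Hex HB.
apply (is_lim_seq_le (sum_n u) (fun _ => B) (Series u) B).
- intros n. rewrite sum_n_Reals. apply HB.
- exact (Series_correct u Hex).
- apply is_lim_seq_const.
Qed.

Lemma littlewood_partial (phi f : C -> C) (a c : nat -> C) (r : R) (m K : nat) :
  holomorphic_on_disc phi -> (forall z, in_disc z -> in_disc (phi z)) ->
  taylor_coeffs f a -> sq_summable a -> taylor_coeffs (fun z => f (phi z)) c ->
  0 < r < 1 ->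
  let x := Cmod (phi (RtoC 0)) in
  sum_f_R0 (fun n => Cmod (c n) ^ 2 * (r ^ 2) ^ n) K <=
    (1 + x) / (1 - x) * Series (fun n => Cmod (a n) ^ 2)
    - x ^ S m / (1 - x) * Cmod (a m) ^ 2.
Proof.
intros Hphi Hself Hf Ha Hc Hr x. apply le_epsilon. intros eps Heps.
assert (Hx : 0 <= x < 1).
{ split; [apply Cmod_ge_0|]. apply Hself. unfold in_disc. rewrite Cmod_0. lra. }
destruct (holomorphic_circle_compact phi r Hphi Hself Hr) as [s [Hs Hphis]].
destruct (taylor_coeffs_Cmod_sqr f a s eps Hf Hs Heps) as [N0 HN0].
(* N >= m keeps the defect term of index m inside the truncation. *)
set (N := (N0 + m)%nat).
(* The added [eps] absorbs the error of replacing f by its truncation on |w| <= s. *)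
set (G := fun z => (energy 1 N a (phi z) + RtoC eps)%C).
assert (HreG : forall z, Re (G z) = Re (energy 1 N a (phi z)) + eps) by reflexivity.
eapply Rle_trans.
- apply (bessel_majorant (fun z => f (phi z)) G c r K Hc); [|exact Hr|].
  + intros z Hz. apply ex_derive_C_plus; [|apply ex_derive_C_const].
    apply ex_derive_energy, Hphi, Hz.
  + intros t Ht. rewrite HreG. specialize (Hphis t Ht).
    specialize (HN0 N _ ltac:(unfold N; lia) Hphis). apply Rabs_le_between in HN0.
    assert (HE := Re_energy_ge 1 N a (phi (polar r t))).
    assert (Cmod (phi (polar r t)) ^ 2 <= 1)
      by (generalize (Cmod_ge_0 (phi (polar r t))); nra).
    specialize (HE H). lra.
- rewrite HreG. apply Rplus_le_compat_r.
  eapply Rle_trans; [apply Re_energy_le; apply Hx|]. fold x.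
  set (v := fun n => x ^ S n / (1 - x) * Cmod (a n) ^ 2).
  assert (Hv : forall n, 0 <= v n).
  { intros n. apply Rmult_le_pos; [|apply pow2_ge_0].
    apply Rdiv_le_0_compat; [apply pow_le; lra | lra]. }
  assert (Hsplit : sum_f_R0 (fun n => Cmod (a n) ^ 2 * ((1 + x) / (1 - x) - x ^ S n / (1 - x))) N
    = (1 + x) / (1 - x) * sum_f_R0 (fun n => Cmod (a n) ^ 2) N - sum_f_R0 v N).
  { rewrite scal_sum, <- minus_sum. apply sum_eq. intros n _. unfold v. ring. }
  rewrite Hsplit.
  assert (H1 := sum_f_R0_le_Series (fun n => Cmod (a n) ^ 2) N (fun n => pow2_ge_0 _) Ha).
  assert (H2 : v m <= sum_f_R0 v N).
  { unfold N. exact (sum_f_R0_ge_term v m N0 Hv). }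
  apply (Rmult_le_compat_l ((1 + x) / (1 - x))) in H1; [|apply Rdiv_le_0_compat; lra].
  unfold v in H2 at 1. lra.
Qed.

(** Let r tend to 1 in [littlewood_partial] for each fixed partial sum, then let the partial sums
    grow. *)
Lemma littlewood_strict (phi f : C -> C) (a c : nat -> C) (m : nat) :
  holomorphic_on_disc phi -> (forall z, in_disc z -> in_disc (phi z)) ->
  taylor_coeffs f a -> sq_summable a -> taylor_coeffs (fun z => f (phi z)) c ->
  sq_summable c ->
  let x := Cmod (phi (RtoC 0)) in
  Series (fun n => Cmod (c n) ^ 2) <=
    (1 + x) / (1 - x) * Series (fun n => Cmod (a n) ^ 2)
    - x ^ S m / (1 - x) * Cmod (a m) ^ 2.
Proof.
intros Hphi Hself Hf Ha Hc Hcs x.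
set (B := (1 + x) / (1 - x) * Series (fun n => Cmod (a n) ^ 2)
    - x ^ S m / (1 - x) * Cmod (a m) ^ 2).
apply Series_le_bound; [exact Hcs|]. intros K.
set (T := sum_f_R0 (fun n => Cmod (c n) ^ 2) K).
(* Since (r^2)^K <= (r^2)^n for n <= K, one common factor comes out of the sum. *)
assert (Hr : forall r, 0 < r < 1 -> (r ^ 2) ^ K * T <= B).
{ intros r Hr.
  eapply Rle_trans; [|exact (littlewood_partial phi f a c r m K Hphi Hself Hf Ha Hc Hr)].
  unfold T. rewrite scal_sum. apply sum_Rle. intros n Hn.
  apply Rmult_le_compat_l; [apply pow2_ge_0|].
  replace K with (n + (K - n))%nat by lia. rewrite pow_add.
  rewrite <- (Rmult_1_r ((r ^ 2) ^ n)) at 2.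
  apply Rmult_le_compat_l; [apply pow_le, pow2_ge_0|].
  rewrite <- (pow1 (K - n)). apply pow_incr. nra. }
(* The radii 1 - 1/(n+2) start at 1/2, hence stay strictly between 0 and 1. *)
assert (Hcont : is_lim_seq (fun n => ((1 - / INR (S (S n))) ^ 2) ^ K * T) T).
{ replace (Finite T) with (Rbar_mult (((1 - 0) ^ 2) ^ K) T)
    by (simpl; f_equal; rewrite Rminus_0_r, !Rmult_1_r, pow1; ring).
  assert (Hinv : is_lim_seq (fun n => 1 - / INR (S (S n))) (1 - 0)).
  { apply is_lim_seq_minus'; [apply is_lim_seq_const|].
    apply (is_lim_seq_incr_1 (fun n => / INR (S n))), (is_lim_seq_incr_1 (fun n => / INR n)).
    apply (is_lim_seq_inv INR p_infty); [apply is_lim_seq_INR | discriminate]. }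
  apply is_lim_seq_mult'; [|apply is_lim_seq_const].
  apply (is_lim_seq_continuous (fun y => (y ^ 2) ^ K)); [|exact Hinv].
  apply derivable_continuous_pt. apply ex_derive_Reals_0. auto_derive. exact I. }
apply (is_lim_seq_le _ (fun _ => B) T B) in Hcont; [exact Hcont | | apply is_lim_seq_const].
intros n. apply Hr.
assert (0 < / INR (S (S n))) by (apply Rinv_0_lt_compat, lt_0_INR; lia).
assert (/ INR (S (S n)) < 1).
{ rewrite <- Rinv_1. apply Rinv_lt_contravar; [rewrite Rmult_1_l; apply lt_0_INR; lia|].
  rewrite <- INR_1. apply lt_INR. lia. }
lra.
Qed.

(** * The equality case *)

Lemma horner_sum_zero (N : nat) (a : nat -> C) (z : C) :
  (forall n, a n = RtoC 0) -> horner_sum N a z = RtoC 0.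
Proof.
revert a. induction N as [|N IH]; intros a Ha; simpl; rewrite Ha.
- reflexivity.
- rewrite IH by (intros n; apply Ha). ring.
Qed.

(** [Series] is 0 on a divergent series of nonnegative terms, so the equation for [H2_norm c] is
    paired with [sq_summable c]. *)
Theorem theorem2p1 (phi : C -> C) :
  inner_function phi -> phi (RtoC 0) <> RtoC 0 ->
  forall (f : C -> C) (a : nat -> C),
    taylor_coeffs f a -> sq_summable a ->
    forall c : nat -> C, taylor_coeffs (fun z => f (phi z)) c ->
      ((sq_summable c /\
        H2_norm c = sqrt ((1 + Cmod (phi (RtoC 0))) / (1 - Cmod (phi (RtoC 0)))) * H2_norm a)
       <-> (forall z : C, in_disc z -> f z = RtoC 0)).
Proof.
intros (Hphi & Hself & _) Hphi0 f a Hf Ha c Hc.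
set (x := Cmod (phi (RtoC 0))).
(* Positivity, from phi(0) <> 0, makes every defect coefficient x^(m+1)/(1-x) positive. *)
assert (Hx : 0 < x < 1).
{ split; [apply Cmod_gt_0, Hphi0|]. apply Hself. unfold in_disc. rewrite Cmod_0. lra. }
split.
- intros [Hcs Hnorm].
  assert (Hpos : forall b : nat -> C, sq_summable b -> 0 <= Series (fun n => Cmod (b n) ^ 2)).
  { intros b Hb. eapply Rle_trans; [|apply (sum_f_R0_le_Series _ 0); [|exact Hb]].
    - apply pow2_ge_0.
    - intros n. apply pow2_ge_0. }
  assert (Hsq : Series (fun n => Cmod (c n) ^ 2) =
                (1 + x) / (1 - x) * Series (fun n => Cmod (a n) ^ 2)).
  { unfold H2_norm in Hnorm.
    rewrite <- (sqrt_sqrt (Series (fun n => Cmod (c n) ^ 2))) by auto.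
    rewrite Hnorm. fold x.
    rewrite <- (sqrt_sqrt ((1 + x) / (1 - x))) at 3 by (apply Rdiv_le_0_compat; lra).
    rewrite <- (sqrt_sqrt (Series (fun n => Cmod (a n) ^ 2))) at 3 by auto. ring. }
  (* Equality of norms leaves no room for the defect term, whichever m is taken. *)
  assert (Ha0 : forall m, a m = RtoC 0).
  { intros m. apply Cmod_eq_0.
    assert (H := littlewood_strict phi f a c m Hphi Hself Hf Ha Hc Hcs).
    cbv zeta in H. fold x in H. rewrite Hsq in H.
    assert (0 < x ^ S m / (1 - x)) by (apply Rdiv_lt_0_compat; [apply pow_lt|]; lra).
    assert (Cmod (a m) ^ 2 <= 0) by nra.
    generalize (Cmod_ge_0 (a m)). nra. }
  intros z Hz. apply Cmod_eq_0.
  assert (Hlim := is_series_C_approx _ _ (Hf z Hz)).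
  apply Rle_antisym; [|apply Cmod_ge_0]. apply le_epsilon. intros eps Heps.
  destruct (Hlim eps Heps) as [N HN]. specialize (HN N (Nat.le_refl N)).
  rewrite sum_n_horner_sum, horner_sum_zero in HN by exact Ha0.
  rewrite <- Cmod_opp. replace (- f z)%C with (0 - f z)%C by ring. lra.
- intros Hf0.
  assert (Ha0 := taylor_coeffs_zero f a Hf Hf0).
  (* The map phi sends the disc into itself, so f o phi vanishes there too. *)
  assert (Hc0 := taylor_coeffs_zero _ c Hc (fun z Hz => Hf0 _ (Hself z Hz))).
  assert (Hzero : forall b : nat -> C, (forall n, b n = RtoC 0) ->
    is_series (fun n => Cmod (b n) ^ 2) 0).
  { intros b Hb. rewrite <- (Rmult_0_l (/ (1 - 0))).
    apply is_series_ext with (fun n => 0 * 0 ^ n).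
    - intros n. rewrite Hb, Cmod_0. simpl. ring.
    - apply (is_series_scal (V := R_NormedModule) 0 (fun n => 0 ^ n)), is_series_geom. rewrite Rabs_R0. lra. }
  split; [exists 0; apply Hzero, Hc0|].
  unfold H2_norm.
  rewrite (is_series_unique _ _ (Hzero a Ha0)), (is_series_unique _ _ (Hzero c Hc0)).
  rewrite sqrt_0. ring.
Qed.
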